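(* Let $\tilde A_i=(a_i;\,l_i^{\mu L},r_i^{\mu L},l_i^{\mu U},r_i^{\mu U};\,l_i^{\nu L},r_i^{\nu L},l_i^{\nu U},r_i^{\nu U})_{LR}$, $i=1,2$, be $LR$-type IVIFNs with the same shape functions, where $a_1+r_1^{\mu U}<0$ and $a_1+r_1^{\nu U}\ge0$, and $\tilde A_2$ is arbitrary. Then $\tilde A_1\odot\tilde A_2=(a;\,l^{\mu L},r^{\mu L},l^{\mu U},r^{\mu U};\,l^{\nu L},r^{\nu L},l^{\nu U},r^{\nu U})_{LR}$, where $a=a_1a_2$; for each $\kappa\in\{\mu L,\mu U\}$, $$l^\kappa=a_1a_2-\min\{(a_1+r_1^\kappa)(a_2+r_2^\kappa),(a_1-l_1^\kappa)(a_2+r_2^\kappa)\},\quad r^\kappa=\max\{(a_1-l_1^\kappa)(a_2-l_2^\kappa),(a_1+r_1^\kappa)(a_2-l_2^\kappa)\}-a_1a_2;$$ and for each $\kappa\in\{\nu L,\nu U\}$, $$l^\kappa=a_1a_2-\min\{(a_1-l_1^\kappa)(a_2+r_2^\kappa),(a_1+r_1^\kappa)(a_2-l_2^\kappa)\},\quad r^\kappa=\max\{(a_1+r_1^\kappa)(a_2+r_2^\kappa),(a_1-l_1^\kappa)(a_2-l_2^\kappa)\}-a_1a_2.$$ Moreover the conditions for an $LR$-type representation hold: all eight spreads of the product are positive and $l^{\mu U}\ge l^{\mu L}$, $l^{\nu L}\ge l^{\nu U}$, $l^{\nu L}\ge l^{\mu L}$, $l^{\nu U}\ge l^{\mu U}$,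 and likewise with $r$ in place of $l$.
   Context: A shape function is a continuous, strictly decreasing, invertible $f:[0,\infty)\to[0,1]$ with $f(0)=1$ and $\lim_{x\to\infty}f(x)=0$. Fix shape functions $L,R,L',R'$. An $LR$-type interval-valued intuitionistic fuzzy number (IVIFN) is written $\tilde A=(a;l^{\mu L},r^{\mu L},l^{\mu U},r^{\mu U};l^{\nu L},r^{\nu L},l^{\nu U},r^{\nu U})_{LR}$, where $a\in\mathbb R$ is its mean value and the eight spreads are positive reals with $l^{\mu U}\ge l^{\mu L}$, $r^{\mu U}\ge r^{\mu L}$, $l^{\nu L}\ge l^{\nu U}$, $r^{\nu L}\ge r^{\nu U}$, $l^{\nu L}\ge l^{\mu L}$, $r^{\nu L}\ge r^{\mu L}$, $l^{\nu U}\ge l^{\mu U}$, $r^{\nu U}\ge r^{\mu U}$. It encodes a lower membership function equal to $L((a-x)/l^{\mu L})$ on $[a-l^{\mu L},a]$, $R((x-a)/r^{\mu L})$ on $[a,a+r^{\mu L}]$, and $0$ otherwise; an upper membership function of the same form with $L',R',l^{\mu U},r^{\mu U}$; a lower non-membership function equal to $1-L((a-x)/l^{\nu L})$ on $[a-l^{\nu L},a]$, $1-R((x-a)/r^{\nu L})$ on $[a,a+r^{\nu L}]$, and $1$ otherwise; and an upper non-membership function of the same form with $L',R',l^{\nu U},r^{\nu U}$. At each $x$ the supremum of the membership interval plus the supremum of the non-membership interval is at most $1$. The product $\tilde A_1\odot\tilde A_2$ is formed cutwise by interval multiplication and read off at the level where the inverse shape functions equal $0$ (giving the mean) and at the level where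 they equal $1$ (giving the spreads). That is, it is the tuple (with the same shape functions) with mean $a=a_1a_2$ and spreads determined, for each $\kappa\in\{\mu L,\mu U,\nu L,\nu U\}$, by $$[a-l^{\kappa},a+r^{\kappa}]=[a_1-l_1^{\kappa},a_1+r_1^{\kappa}]\times[a_2-l_2^{\kappa},a_2+r_2^{\kappa}],$$ where $I\times J=\{xy:x\in I,y\in J\}$. *)

(* Defs.v *)
From HB Require Import structures.
From mathcomp Require Import all_boot all_order all_algebra.
From mathcomp Require Import all_classical all_reals all_analysis.

Set Implicit Arguments.
Unset Strict Implicit.
Unset Printing Implicit Defensive.

Import Order.TTheory GRing.Theory Num.Theory numFieldNormedType.Exports.

Local Open Scope classical_set_scope.
Local Open Scope ring_scope.

(* Only the values of f on [0, +oo[ matter.  A strictly decreasing f with limit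
   0 never reaches 0, so it cannot be invertible onto all of [0, 1]; it is
   invertible onto ]0, 1]. *)
Definition is_shape (R : realType) (f : R -> R) : Prop :=
  [/\ {within `[0, +oo[, continuous f},
      {in `[0, +oo[ &, {homo f : x y /~ x < y}},
      set_bij `[0, +oo[ `]0, 1] f,
      f 0 = 1 &
      f x @[x --> +oo] --> 0].

Record shape_function (R : realType) := ShapeFunction {
  shape_fun :> R -> R;
  shapeP : is_shape shape_fun
}.

(* Lower/upper membership (muL, muU), lower/upper non-membership (nuL, nuU). *)
Inductive kind := muL | muU | nuL | nuU.

(* The shape functions are parameters of the type, so that operands and product
   share them.  The constraints on the spreads are in is_LR below. *)
Record LR_tuple (R : realType) (Lf Rf Lf' Rf' : shape_function R) := LRTuple {
  mean : R;
  l_muL : R; r_muL : R; l_muU : R; r_muU : R;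
  l_nuL : R; r_nuL : R; l_nuU : R; r_nuU : R
}.

Section LR.
Variables (R : realType) (Lf Rf Lf' Rf' : shape_function R).
Implicit Types A B : LR_tuple Lf Rf Lf' Rf'.

Definition lspread A (k : kind) : R :=
  match k with
  | muL => l_muL A | muU => l_muU A | nuL => l_nuL A | nuU => l_nuU A
  end.

Definition rspread A (k : kind) : R :=
  match k with
  | muL => r_muL A | muU => r_muU A | nuL => r_nuL A | nuU => r_nuU A
  end.

Definition is_LR A : Prop :=
  [/\ forall k, 0 < lspread A k /\ 0 < rspread A k,
      lspread A muL <= lspread A muU /\ rspread A muL <= rspread A muU,
      lspread A nuU <= lspread A nuL /\ rspread A nuU <= rspread A nuL,
      lspread A muL <= lspread A nuL /\ rspread A muL <= rspread A nuL &
      lspread A muU <= lspread A nuU /\ rspread A muU <= rspread A nuU].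

(* The two branches agree at x = a, where both shapes take the value 1. *)
Definition LR_profile (f g : shape_function R) (a l r x : R) : R :=
  if a - l <= x <= a then f ((a - x) / l)
  else if a <= x <= a + r then g ((x - a) / r)
  else 0.

Definition LR_fun A (k : kind) (x : R) : R :=
  let a := mean A in let l := lspread A k in let r := rspread A k in
  match k with
  | muL => LR_profile Lf Rf a l r x
  | muU => LR_profile Lf' Rf' a l r x
  | nuL => 1 - LR_profile Lf Rf a l r x
  | nuU => 1 - LR_profile Lf' Rf' a l r x
  end.

(* The suprema of the membership and non-membership intervals at x are their
   upper endpoints. *)
Definition is_IVIFN A : Prop :=
  is_LR A /\ forall x, LR_fun A muU x + LR_fun A nuU x <= 1.

Definition base_interval A (k : kind) : set R :=
  `[mean A - lspread A k, mean A + rspread A k].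

Definition is_product A1 A2 B : Prop :=
  mean B = mean A1 * mean A2 /\
  forall k, base_interval B k =
    [set x * y | x in base_interval A1 k & y in base_interval A2 k].

End LR.

(* Main.v *)
(** The image of a rectangle under multiplication is the interval spanned by the
    products of its corners: a bilinear map is extremal at corners, and values in
    between are attained along a segment of the rectangle.  The spreads of the
    product are read off these extreme corners, and a factor whose interval is
    negative, or contains 0, decides which corners compete.  The spreads are
    positive because a1 != 0, and ordered because the base intervals are nested.
    As shape functions decrease, a profile grows with its spreads, so the upper
    membership of the product is at most 1 minus its upper non-membership. *)
Require Import Defs.
From mathcomp Require Import all_boot all_order all_algebra.
From mathcomp Require Import all_classical all_reals all_analysis.
From mathcomp Require Import lra.

Set Implicit Arguments.
Unset Strict Implicit.
Unset Printing Implicit Defensive.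

Import Order.TTheory GRing.Theory Num.Theory.

Local Open Scope classical_set_scope.
Local Open Scope ring_scope.

(** * Products of compact real intervals *)

Section IntervalProduct.
Variable R : realType.
Implicit Types p q c d x y z : R.

Definition corner_min p q c d : R :=
  Num.min (Num.min (p * c) (p * d)) (Num.min (q * c) (q * d)).

Definition corner_max p q c d : R :=
  Num.max (Num.max (p * c) (p * d)) (Num.max (q * c) (q * d)).

(** For fixed [y] the product is affine in [x], hence minimal at an end; the sign of [y] decides
    which one. *)
Lemma mul_ge_ends p q x y z :
  p <= x <= q -> z <= p * y -> z <= q * y -> z <= x * y.
Proof. by move=> /andP[? ?] ? ?; have [?|?] := lerP 0 y; nra. Qed.

Lemma mul_le_ends p q x y z :
  p <= x <= q -> p * y <= z -> q * y <= z -> x * y <= z.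
Proof. by move=> /andP[? ?] ? ?; have [?|?] := lerP 0 y; nra. Qed.

Lemma corner_min_le p q c d x y :
  p <= x <= q -> c <= y <= d -> corner_min p q c d <= x * y.
Proof.
(* One variable at a time: first [x] is moved to an end, then [y], which leaves the four corners. *)
move=> xpq ycd; apply: (mul_ge_ends xpq); rewrite mulrC;
  apply: (mul_ge_ends ycd); rewrite mulrC !ge_min lexx ?orbT //.
Qed.

Lemma corner_max_ge p q c d x y :
  p <= x <= q -> c <= y <= d -> x * y <= corner_max p q c d.
Proof.
move=> xpq ycd; apply: (mul_le_ends xpq); rewrite mulrC;
  apply: (mul_le_ends ycd); rewrite mulrC !le_max lexx ?orbT //.
Qed.

Lemma corner_min_attained p q c d : p <= q -> c <= d ->
  exists x y, [/\ p <= x <= q, c <= y <= d & corner_min p q c d = x * y].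
Proof.
move=> pq cd; rewrite /corner_min.
(* Each outcome of the comparisons leaves a single corner product, from which [reflexivity] reads
   off the witnesses. *)
by case: (leP (p * c)) => _; case: (leP (q * c)) => _; case: leP => _;
  (do 2 eexists; split; last reflexivity); rewrite ?lexx ?pq ?cd.
Qed.

Lemma corner_max_attained p q c d : p <= q -> c <= d ->
  exists x y, [/\ p <= x <= q, c <= y <= d & corner_max p q c d = x * y].
Proof.
move=> pq cd; rewrite /corner_max.
by case: (leP (p * c)) => _; case: (leP (q * c)) => _; case: leP => _;
  (do 2 eexists; split; last reflexivity); rewrite ?lexx ?pq ?cd.
Qed.

Lemma mul_segment_ivt (x0 y0 x1 y1 z : R) : x0 * y0 <= z <= x1 * y1 ->
  exists2 t, 0 <= t <= 1 & (x0 + t * (x1 - x0)) * (y0 + t * (y1 - y0)) = z.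
Proof.
move=> /andP[zge zle].
(* The product along the segment, minus [z], is a polynomial in the parameter. It is nonpositive at
   0 and nonnegative at 1, so it has a root between them. *)
pose P := (x0%:P + 'X * (x1 - x0)%:P) * (y0%:P + 'X * (y1 - y0)%:P) - z%:P.
have PE t : P.[t] = (x0 + t * (x1 - x0)) * (y0 + t * (y1 - y0)) - z.
  by rewrite /P !hornerE.
have [||t t01 /rootP] := @poly_ivt _ P 0 1; first exact: ler01.
  by rewrite !PE; apply/andP; split; lra.
by rewrite PE => /eqP; rewrite subr_eq0 => /eqP ?; exists t.
Qed.

Lemma between_segment p q x0 x1 t : p <= x0 <= q -> p <= x1 <= q -> 0 <= t <= 1 ->
  p <= x0 + t * (x1 - x0) <= q.
Proof.
by move=> /andP[? ?] /andP[? ?] /andP[? ?]; apply/andP; split; nra.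
Qed.

Lemma itv_mul_image p q c d : p <= q -> c <= d ->
  [set x * y | x in `[p, q] & y in `[c, d]] =
  `[corner_min p q c d, corner_max p q c d]%classic.
Proof.
move=> pq cd; apply/seteqP; split=> z /=.
  move=> [x /= + [y /= + <-]]; rewrite !in_itv /= => xpq ycd.
  by rewrite corner_min_le ?corner_max_ge.
(* The points attaining the two extremes are joined by a segment, which stays in the rectangle by
   convexity. *)
have [x0 [y0 [x0pq y0cd ->]]] := corner_min_attained pq cd.
have [x1 [y1 [x1pq y1cd ->]]] := corner_max_attained pq cd.
rewrite in_itv /= => /mul_segment_ivt[t t01 <-].
exists (x0 + t * (x1 - x0)); first by rewrite in_itv /= between_segment.
by exists (y0 + t * (y1 - y0)) => //; rewrite in_itv /= between_segment.
Qed.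

(** The minimum over the smaller rectangle is attained at a point that also lies in the larger
    one. *)
Lemma corner_min_sub p q c d p' q' c' d' :
  p' <= p -> p <= q -> q <= q' -> c' <= c -> c <= d -> d <= d' ->
  corner_min p' q' c' d' <= corner_min p q c d.
Proof.
move=> p'p pq qq' c'c cd dd'.
have [x [y [/andP[px xq] /andP[cy yd] ->]]] := corner_min_attained pq cd.
by apply: corner_min_le; apply/andP; split; lra.
Qed.

Lemma corner_max_sub p q c d p' q' c' d' :
  p' <= p -> p <= q -> q <= q' -> c' <= c -> c <= d -> d <= d' ->
  corner_max p q c d <= corner_max p' q' c' d'.
Proof.
move=> p'p pq qq' c'c cd dd'.
have [x [y [/andP[px xq] /andP[cy yd] ->]]] := corner_max_attained pq cd.
by apply: corner_max_ge; apply/andP; split; lra.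
Qed.

(** Multiplication by [p] or by [q] reverses [c <= d], so only the corners with [d] compete. *)
Lemma corner_min_neg p q c d : p <= 0 -> q <= 0 -> c <= d ->
  corner_min p q c d = Num.min (q * d) (p * d).
Proof.
move=> p0 q0 cd.
have pdc : p * d <= p * c by apply: ler_wnM2l.
have qdc : q * d <= q * c by apply: ler_wnM2l.
by rewrite /corner_min (min_r pdc) (min_r qdc) minC.
Qed.

Lemma corner_max_neg p q c d : p <= 0 -> q <= 0 -> c <= d ->
  corner_max p q c d = Num.max (p * c) (q * c).
Proof.
move=> p0 q0 cd.
have pdc : p * d <= p * c by apply: ler_wnM2l.
have qdc : q * d <= q * c by apply: ler_wnM2l.
by rewrite /corner_max (max_l pdc) (max_l qdc).
Qed.

(** Multiplication by [p] reverses [c <= d] and multiplication by [q] preserves it, so one corner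
    survives on each side. *)
Lemma corner_min_mixed p q c d : p <= 0 -> 0 <= q -> c <= d ->
  corner_min p q c d = Num.min (p * d) (q * c).
Proof.
move=> p0 q0 cd.
have pdc : p * d <= p * c by apply: ler_wnM2l.
have qcd : q * c <= q * d by apply: ler_wpM2l.
by rewrite /corner_min (min_r pdc) (min_l qcd).
Qed.

Lemma corner_max_mixed p q c d : p <= 0 -> 0 <= q -> c <= d ->
  corner_max p q c d = Num.max (q * d) (p * c).
Proof.
move=> p0 q0 cd.
have pdc : p * d <= p * c by apply: ler_wnM2l.
have qcd : q * c <= q * d by apply: ler_wpM2l.
by rewrite /corner_max (max_l pdc) (max_r qcd) maxC.
Qed.

(** Each endpoint of one interval belongs to the other. Nonemptiness matters because all empty
    intervals are equal as sets. *)
Lemma set_itvcc_inj (a b a' b' : R) : a <= b ->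
  `[a, b]%classic = `[a', b']%classic -> a = a' /\ b = b'.
Proof.
move=> ab E.
have E' x : (a <= x <= b) = (a' <= x <= b').
  have := congr1 (fun X : set R => X x) E; rewrite /= !in_itv /= => e.
  by apply/idP/idP; rewrite e.
have ha := E' a; have hb := E' b; rewrite ?lexx ab /= in ha hb.
have /andP[? ?] := esym ha; have /andP[? ?] := esym hb.
have a'b' : a' <= b' by lra.
have ha' := E' a'; have hb' := E' b'; rewrite ?lexx a'b' /= in ha' hb'.
by move: ha' hb' => /andP[? ?] /andP[? ?]; split; lra.
Qed.

End IntervalProduct.

(** * The product tuple and its spreads *)

Section Product.
Variables (R : realType) (Lf Rf Lf' Rf' : shape_function R).
Implicit Types A B : LR_tuple Lf Rf Lf' Rf'.

Definition low A k := mean A - lspread A k.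
Definition high A k := mean A + rspread A k.

Definition prod_low A1 A2 k :=
  corner_min (low A1 k) (high A1 k) (low A2 k) (high A2 k).
Definition prod_high A1 A2 k :=
  corner_max (low A1 k) (high A1 k) (low A2 k) (high A2 k).

(** The spreads are the distances from the product of the means to the extreme corners. *)
Definition LR_prod A1 A2 : LR_tuple Lf Rf Lf' Rf' :=
  let l k := mean A1 * mean A2 - prod_low A1 A2 k in
  let r k := prod_high A1 A2 k - mean A1 * mean A2 in
  LRTuple Lf Rf Lf' Rf' (mean A1 * mean A2)
    (l muL) (r muL) (l muU) (r muU) (l nuL) (r nuL) (l nuU) (r nuU).

Lemma lspread_LR_prod A1 A2 k :
  lspread (LR_prod A1 A2) k = mean A1 * mean A2 - prod_low A1 A2 k.
Proof. by case: k. Qed.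

Lemma rspread_LR_prod A1 A2 k :
  rspread (LR_prod A1 A2) k = prod_high A1 A2 k - mean A1 * mean A2.
Proof. by case: k. Qed.

Lemma base_interval_LR_prod A1 A2 k :
  base_interval (LR_prod A1 A2) k = `[prod_low A1 A2 k, prod_high A1 A2 k]%classic.
Proof.
by rewrite /base_interval lspread_LR_prod rspread_LR_prod /= subKr addrC subrK.
Qed.

Lemma LR_tuple_ext A B : mean A = mean B ->
  (forall k, lspread A k = lspread B k /\ rspread A k = rspread B k) -> A = B.
Proof.
case: A B => [? ? ? ? ? ? ? ? ?] [? ? ? ? ? ? ? ? ?] /= -> s.
have [/= -> ->] := s muL; have [/= -> ->] := s muU.
by have [/= -> ->] := s nuL; have [/= -> ->] := s nuU.
Qed.

Lemma low_lt_mean A k : is_LR A -> low A k < mean A.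
Proof. by case=> /(_ k)[? ?] *; rewrite /low; lra. Qed.

Lemma mean_lt_high A k : is_LR A -> mean A < high A k.
Proof. by case=> /(_ k)[? ?] *; rewrite /high; lra. Qed.

Lemma low_le_high A k : is_LR A -> low A k <= high A k.
Proof.
by move=> hA; exact/ltW/(lt_trans (low_lt_mean k hA))/mean_lt_high.
Qed.

Lemma is_product_LR_prod A1 A2 B : is_LR A1 -> is_LR A2 ->
  is_product A1 A2 B <-> B = LR_prod A1 A2.
Proof.
move=> hA1 hA2.
have img k : [set x * y | x in base_interval A1 k & y in base_interval A2 k] =
    base_interval (LR_prod A1 A2) k.
  by rewrite base_interval_LR_prod -itv_mul_image //; exact: low_le_high.
split=> [[mB hB]|->]; last by split=> // k; rewrite img.
apply: LR_tuple_ext => // k.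
have := hB k; rewrite img => /esym/set_itvcc_inj[].
  (* The interval is nonempty: the product of the means lies between the extreme corners. *)
  rewrite lspread_LR_prod rspread_LR_prod /= subKr addrC subrK.
  by apply: (@le_trans _ _ (mean A1 * mean A2));
    [apply: corner_min_le|apply: corner_max_ge];
    rewrite !ltW ?low_lt_mean ?mean_lt_high.
rewrite mB /= => e1 e2; split; lra.
Qed.

(** With the first factor held at its nonzero mean, moving the second from its mean to an end
    changes the product strictly, down at one end and up at the other. *)
Lemma LR_prod_spread_gt0 A1 A2 k : is_LR A1 -> is_LR A2 -> mean A1 != 0 ->
  0 < lspread (LR_prod A1 A2) k /\ 0 < rspread (LR_prod A1 A2) k.
Proof.
move=> hA1 hA2 a1n0; rewrite lspread_LR_prod rspread_LR_prod !subr_gt0.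
have l1 := low_lt_mean k hA1; have h1 := mean_lt_high k hA1.
have l2 := low_lt_mean k hA2; have h2 := mean_lt_high k hA2.
have m1 : low A1 k <= mean A1 <= high A1 k by rewrite !ltW.
have in_l : low A2 k <= low A2 k <= high A2 k by rewrite lexx low_le_high.
have in_h : low A2 k <= high A2 k <= high A2 k by rewrite lexx low_le_high.
have minl := corner_min_le m1 in_l; have minh := corner_min_le m1 in_h.
have maxl := corner_max_ge m1 in_l; have maxh := corner_max_ge m1 in_h.
have [a1lt0|a1gt0|a10] := ltrgt0P (mean A1); last by rewrite a10 eqxx in a1n0.
(* The positive case comes first: here [a1lt0] reads [0 < mean A1]. *)
- by split; [apply: le_lt_trans minl _|apply: lt_le_trans maxh];
    rewrite ltr_pM2l.
- by split; [apply: le_lt_trans minh _|apply: lt_le_trans maxl];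
    rewrite ltr_nM2l.
Qed.

Definition spread_le A k k' :=
  lspread A k <= lspread A k' /\ rspread A k <= rspread A k'.

(** Intervals around a common mean are nested when their spreads are ordered, and so are the
    rectangles they span. *)
Lemma LR_prod_spread_le A1 A2 k k' : is_LR A1 -> is_LR A2 ->
  spread_le A1 k k' -> spread_le A2 k k' -> spread_le (LR_prod A1 A2) k k'.
Proof.
move=> hA1 hA2 [l1 r1] [l2 r2].
rewrite /spread_le !lspread_LR_prod !rspread_LR_prod lerD2l lerN2 lerD2r.
by split; [apply: corner_min_sub|apply: corner_max_sub];
  rewrite ?low_le_high // /low /high ?lerD2l ?lerN2.
Qed.

Lemma LR_prod_is_LR A1 A2 : is_LR A1 -> is_LR A2 -> mean A1 != 0 ->
  is_LR (LR_prod A1 A2).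
Proof.
move=> hA1 hA2 a1n0; case: (hA1) (hA2) => [? ? ? ? ?] [? ? ? ? ?].
by split; [move=> k; exact: LR_prod_spread_gt0|..]; exact: LR_prod_spread_le.
Qed.

(** * Monotonicity of profiles in their spreads *)

Lemma shape_ge0 (f : shape_function R) x : 0 <= x -> 0 <= f x.
Proof.
case: (shapeP f) => _ _ [fun_f _ _] _ _ x0.
have : (`]0, 1]%classic : set R) (f x) by apply: fun_f; rewrite /= in_itv /= x0.
by rewrite /= in_itv /= => /andP[/ltW].
Qed.

Lemma shape_le (f : shape_function R) x y : 0 <= x -> x <= y -> f y <= f x.
Proof.
case: (shapeP f) => _ dec_f _ _ _ x0; rewrite le_eqVlt => /orP[/eqP->//|xy].
apply/ltW/dec_f; rewrite ?in_itv /= ?andbT //.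
exact/(le_trans x0)/ltW.
Qed.

Lemma shape_scale_le (f : shape_function R) (x s t : R) :
  0 <= x -> 0 < s -> s <= t -> f (x / s) <= f (x / t).
Proof.
move=> x0 s0 st; have t0 := lt_le_trans s0 st.
apply: shape_le; first by rewrite divr_ge0 // ltW.
by rewrite ler_wpM2l // lef_pV2 // ?posrE.
Qed.

Lemma LR_profile_ge0 (f g : shape_function R) a l r x : 0 < l -> 0 < r ->
  0 <= LR_profile f g a l r x.
Proof.
move=> l0 r0; rewrite /LR_profile.
case: ifPn => [/andP[_ ?]|_]; first by rewrite shape_ge0 // divr_ge0 ?subr_ge0 // ltW.
case: ifPn => // /andP[? _].
by rewrite shape_ge0 // divr_ge0 ?subr_ge0 // ltW.
Qed.

Lemma LR_profile_le (f g : shape_function R) a l r l' r' x :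
  0 < l -> 0 < r -> l <= l' -> r <= r' ->
  LR_profile f g a l r x <= LR_profile f g a l' r' x.
Proof.
move=> l0 r0 ll' rr'.
have l'0 := lt_le_trans l0 ll'; have r'0 := lt_le_trans r0 rr'.
(* This settles the points outside the narrower support, where the left side is 0. *)
have g0 := LR_profile_ge0 f g a x l'0 r'0.
rewrite {1}/LR_profile; case: ifPn => [/andP[lx xa]|nl].
  rewrite /LR_profile xa andbT ifT; last by lra.
  by apply: shape_scale_le; rewrite ?subr_ge0.
case: ifPn => // /andP[ax xr].
(* The point [a] belongs to the left branch, so here [x] is strictly to its right and the wider
   profile also takes its right branch. *)
have {nl}ltax : a < x.
  rewrite lt_neqAle ax andbT; apply: contraNneq nl => <-; lra.
rewrite /LR_profile (lt_geF ltax) andbF ax ifT; last by lra.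
by apply: shape_scale_le; rewrite ?subr_ge0.
Qed.

(** Both upper functions use the shapes [Lf'] and [Rf'], so the bound compares two profiles whose
    spreads are ordered. *)
Lemma is_LR_IVIFN A : is_LR A -> is_IVIFN A.
Proof.
move=> hA; split=> // x; case: hA => pos _ _ _ [ll rr].
have [l0 r0] := pos muU.
have := @LR_profile_le Lf' Rf' (mean A) _ _ _ _ x l0 r0 ll rr.
by rewrite /LR_fun; lra.
Qed.

End Product.

(** * First factor with negative membership supports and non-membership supports reaching 0 *)

Theorem proposition3p1p9 (R : realType) (Lf Rf Lf' Rf' : shape_function R)
  (A1 A2 : LR_tuple Lf Rf Lf' Rf')
  (hA1 : is_IVIFN A1) (hA2 : is_IVIFN A2)
  (hmu : mean A1 + rspread A1 muU < 0)
  (hnu : 0 <= mean A1 + rspread A1 nuU) :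
  let a1 := mean A1 in let l1 := lspread A1 in let r1 := rspread A1 in
  let a2 := mean A2 in let l2 := lspread A2 in let r2 := rspread A2 in
  exists A : LR_tuple Lf Rf Lf' Rf',
    (forall B, is_product A1 A2 B <-> B = A) /\
    mean A = a1 * a2 /\
    (forall k, k = muL \/ k = muU ->
      lspread A k = a1 * a2 - Num.min ((a1 + r1 k) * (a2 + r2 k))
                                      ((a1 - l1 k) * (a2 + r2 k)) /\
      rspread A k = Num.max ((a1 - l1 k) * (a2 - l2 k))
                            ((a1 + r1 k) * (a2 - l2 k)) - a1 * a2) /\
    (forall k, k = nuL \/ k = nuU ->
      lspread A k = a1 * a2 - Num.min ((a1 - l1 k) * (a2 + r2 k))
                                      ((a1 + r1 k) * (a2 - l2 k)) /\
      rspread A k = Num.max ((a1 + r1 k) * (a2 + r2 k))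
                            ((a1 - l1 k) * (a2 - l2 k)) - a1 * a2) /\
    is_IVIFN A.

Proof.
move=> a1 l1 r1 a2 l2 r2.
have [[LR1 _] [LR2 _]] := (hA1, hA2).
have [pos1 [_ mu_r] [_ nu_r] _ _] := LR1.
have a1_lt0 : a1 < 0.
  by apply: lt_trans hmu; exact: (mean_lt_high muU LR1).
have low_le0 k : low A1 k <= 0.
  by apply/ltW/(lt_trans _ a1_lt0)/low_lt_mean.
exists (LR_prod A1 A2); split; first by move=> B; exact: is_product_LR_prod.
split=> //; split=> [k k_mu|].
  (* The sign at [muU] passes to [muL], whose right spread is no larger. *)
  have high_le0 : high A1 k <= 0 by case: k_mu => ->; rewrite /high; lra.
  rewrite lspread_LR_prod rspread_LR_prod /prod_low /prod_high.
  by rewrite corner_min_neg ?corner_max_neg ?low_le_high.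
split=> [k k_nu|]; last by apply/is_LR_IVIFN/LR_prod_is_LR; rewrite ?lt_eqF.
(* The sign at [nuU] passes to [nuL], whose right spread is no smaller. *)
have high_ge0 : 0 <= high A1 k by case: k_nu => ->; rewrite /high; lra.
rewrite lspread_LR_prod rspread_LR_prod /prod_low /prod_high.
by rewrite corner_min_mixed ?corner_max_mixed ?low_le_high.
Qed.
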